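(* Let $G$ be a finite connected graph of order $n$ with minimum degree $\delta(G)$. If \[ \delta(G) \geq \Big\lfloor \frac{n+2}{4} \Big\rfloor , \] then $G^2$ is maximally edge-connected, i.e. $\lambda(G^2)=\delta(G^2)$.
   Context: All graphs are finite and simple. The square $G^2$ of a graph $G$ is the graph on the vertex set $V(G)$ in which two distinct vertices are adjacent if and only if their distance in $G$ is at most $2$. The edge-connectivity $\lambda(G)$ is the minimum number of edges whose removal disconnects $G$; $\delta(G)$ is the minimum degree. A graph is maximally edge-connected if its edge-connectivity equals its minimum degree. *)

(* Defs.v *)
From mathcomp Require Import all_boot.

Set Implicit Arguments.
Unset Strict Implicit.
Unset Printing Implicit Defensive.

(* A finite simple graph is a symmetric irreflexive relation
   [e : rel T] (adjacency) on a finite type [T] of vertices. *)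

Definition simple_graph (T : finType) (e : rel T) : Prop :=
  symmetric e /\ irreflexive e.

(* The graph without vertices does not count as connected. *)
Definition connected_graph (T : finType) (e : rel T) : bool :=
  (0 < #|T|) && [forall x, forall y, connect e x y].

Definition degree (T : finType) (e : rel T) (x : T) : nat := #|[set y | e x y]|.

(* Every degree is less than #|T|, so the default value #|T| is only ever
   returned for the graph without vertices. *)
Definition min_degree (T : finType) (e : rel T) : nat :=
  \big[minn/#|T|]_(x : T) degree e x.

Definition has_walk (T : finType) (e : rel T) (k : nat) (x y : T) : bool :=
  [exists p : k.-tuple T, path e x p && (last x p == y)].

(* Least length of a walk from x to y.  A shortest walk has distinct vertices,
   hence length less than #|T|; the value is meaningless (namely #|T|) exactly
   when y is not reachable from x, where the distance is infinite. *)
Definition dist (T : finType) (e : rel T) (x y : T) : nat :=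
  find (fun k => has_walk e k x y) (iota 0 #|T|).

Definition square (T : finType) (e : rel T) : rel T :=
  fun x y => [&& x != y, connect e x y & dist e x y <= 2].

Definition edges (T : finType) (e : rel T) : {set {set T}} :=
  [set [set u.1; u.2] | u : T * T & e u.1 u.2].

Definition delete_edges (T : finType) (e : rel T) (F : {set {set T}}) : rel T :=
  fun x y => e x y && ([set x; y] \notin F).

Definition disconnects (T : finType) (e : rel T) (F : {set {set T}}) : bool :=
  (F \subset edges e) && ~~ connected_graph (delete_edges e F).

(* With at least two vertices, the set of all edges disconnects, so the default
   value does not affect the minimum.  On a single vertex no edge set
   disconnects, and the value is 0, the usual convention. *)
Definition edge_connectivity (T : finType) (e : rel T) : nat :=
  \big[minn/#|edges e|]_(F : {set {set T}} | disconnects e F) #|F|.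

Definition maximally_edge_connected (T : finType) (e : rel T) : Prop :=
  edge_connectivity e = min_degree e.

(* Main.v *)
(* Let [H] be the square of [G], let [X | Y] be a cut of [H] of size less than
   [delta(H)] with [|X| <= n / 2], and write [d = delta(G)], so [n <= 4 d + 1].
   Both sides contain vertices without [H]-neighbours across the cut; such a
   vertex [x] of [X] gives [delta(H) < |X| <= 2 d], so the cut has size at most
   [2 d - 2].
   For every [c] the closed neighbourhood [N[c]] is a clique of [H], and by
   connectedness of [G] the cut is never contained in that clique.  Hence if
   [N[c]] has at least two vertices on both sides, the cut has size at least
   [2 (d - 1) + 1], a contradiction.
   If [v] in [Y] has a neighbour in [X], then [N[v]] is disjoint from [N[x]],
   so [N[v]] has at most [d - 1] vertices in [X], hence at least two in [Y],
   hence only one in [X].  Choose an edge [u v] across the cut such that [u]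
   also has a neighbour in [X]; then [v] is the only neighbour of [u] in [Y],
   [N(u)] and [N(v)] are disjoint, and since [u] and [v] are [H]-adjacent to
   all of [N(u)] and [N(v)] the cut has at least [2 d - 1] edges. *)
Require Import Defs.
From mathcomp Require Import all_boot zify.

Set Implicit Arguments.
Unset Strict Implicit.
Unset Printing Implicit Defensive.

(** * Minima over finite types, degrees and edge counts *)

Lemma bigminn_le (I : finType) (P : pred I) (F : I -> nat) (m : nat) (i : I) :
  P i -> \big[minn/m]_(j | P j) F j <= F i.
Proof.
move=> Pi; have := mem_index_enum i.
elim: (index_enum I) => [//|j r IHr]; rewrite inE big_cons => /predU1P[<-|ir].
  by rewrite Pi geq_minl.
by case: ifP => _; rewrite ?geq_min ?IHr ?orbT.
Qed.

Lemma bigminn_ge (I : finType) (P : pred I) (F : I -> nat) (m k : nat) :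
  k <= m -> (forall i, P i -> k <= F i) -> k <= \big[minn/m]_(i | P i) F i.
Proof.
move=> km kF; apply: (big_ind (fun v => k <= v)) => // a b ka kb.
by rewrite leq_min ka.
Qed.

Lemma min_degree_le (T : finType) (e : rel T) (x : T) :
  min_degree e <= degree e x.
Proof. exact: bigminn_le. Qed.

Lemma degree_lt_card (T : finType) (e : rel T) (x : T) :
  irreflexive e -> degree e x < #|T|.
Proof.
move=> irr; rewrite -cardsT; apply: proper_card; rewrite properT.
by apply/eqP => /setP/(_ x); rewrite !inE irr.
Qed.

Lemma set2_inj (T : finType) (x : T) : injective (fun y => [set x; y]).
Proof.
move=> y z /setP eq_yz; have := eq_yz y; have := eq_yz z.
rewrite !inE !eqxx !orbT (eq_sym z y).
by case: (eqVneq y z) => // _; rewrite !orbF => /eqP -> /esym/eqP.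
Qed.

Lemma degree_le_edges (T : finType) (e : rel T) (x : T) :
  degree e x <= #|edges e|.
Proof.
rewrite /degree -(card_imset _ (@set2_inj T x)).
apply/subset_leq_card/subsetP => _ /imsetP[y exy ->].
by apply/imsetP; exists (x, y); rewrite // inE; rewrite inE in exy.
Qed.

(** Follow a path from [x] to [y] up to its first vertex outside [W]. *)
Lemma connected_leaving_edge (T : finType) (e : rel T) (W : {set T}) (x y : T) :
  connected_graph e -> x \in W -> y \notin W ->
  exists u v, [/\ u \in W, v \notin W & e u v].
Proof.
move=> /andP[_ /forallP/(_ x)/forallP/(_ y)/connectP[p]].
elim: p x => [|z p IHp] x /= => [_ -> -> //|/andP[exz pz] yl xW yW].
have [zW|zW] := boolP (z \in W); first exact: IHp pz yl zW yW.
by exists x, z.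
Qed.

(** Deleting all edges at [x] isolates it from any other vertex. With at most one vertex there are
    no edges, and the left side is 0. *)
Lemma edge_connectivity_le_degree (T : finType) (e : rel T) (x : T) :
  symmetric e -> irreflexive e -> edge_connectivity e <= degree e x.
Proof.
move=> sym irr; set F := [set [set x; y] | y in [set y | e x y]].
have [/fintype_le1P T1|/card_gt1P[y [z [_ _ nyz]]]] := leqP #|T| 1.
  suff -> : edge_connectivity e = 0 by [].
  apply/eqP; rewrite -leqn0; have E0 : edges e = set0.
    apply/setP => B; rewrite [RHS]inE; apply/imsetP => -[[u v]].
    by rewrite inE /= (T1 v u) irr.
  rewrite -[X in _ <= X](cards0 {set T}) -E0.
  apply: (big_ind (fun v => v <= #|edges e|)) => [//|a b ab _|B].
    by rewrite geq_min ab.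
  by case/andP => /subset_leq_card.
apply: (@leq_trans #|F|); last exact: leq_imset_card.
apply: bigminn_le; apply/andP; split.
  apply/subsetP => _ /imsetP[w exw ->].
  by apply/imsetP; exists (x, w); rewrite // inE; rewrite inE in exw.
apply/negP => con.
have [w nwx] : exists w, w != x.
  have [eyx|] := eqVneq y x; last by exists y.
  by exists z; rewrite -eyx eq_sym.
have w_out : w \notin [set x] by rewrite inE.
have [u [v [/set1P -> _ /andP[exv /negP[]]]]] :=
  connected_leaving_edge con (set11 x) w_out.
by apply/imsetP; exists v; rewrite ?inE.
Qed.

(** * Cuts and edge-connectivity *)

Definition cut (T : finType) (e : rel T) (X : {set T}) : {set T * T} :=
  [set p | [&& p.1 \in X, p.2 \notin X & e p.1 p.2]].

Lemma card_cutC (T : finType) (e : rel T) (X : {set T}) :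
  symmetric e -> #|cut e (~: X)| = #|cut e X|.
Proof.
move=> sym; have sw_inj : injective (fun p : T * T => (p.2, p.1)).
  by move=> [a b] [c d] [-> ->].
rewrite -(card_imset _ sw_inj); congr #|pred_of_set _|; apply/setP => -[a b].
apply/imsetP/idP => [[[c d]]|].
  by rewrite !inE /= negbK => /and3P[cX dX ecd] [-> ->]; rewrite dX cX sym.
rewrite inE /= => /and3P[aX bX eab]; exists (b, a) => //.
by rewrite !inE /= bX aX sym.
Qed.

(** If deleting [F] disconnects the graph, some component [X] of what remains is proper, and every
    edge leaving [X] belongs to [F]. *)
Lemma edge_connectivity_ge (T : finType) (e : rel T) (k : nat) :
  0 < #|T| -> k <= #|edges e| ->
  (forall X : {set T}, X != set0 -> X != setT -> k <= #|cut e X|) ->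
  k <= edge_connectivity e.
Proof.
move=> T_gt0 kE kcut; apply: bigminn_ge => // F /andP[_].
rewrite /connected_graph T_gt0 /= negb_forall => /existsP[x].
rewrite negb_forall => /existsP[y nxy].
set X := [set z | connect (delete_edges e F) x z].
have X0 : X != set0 by apply/set0Pn; exists x; rewrite inE connect0.
have XT : X != setT by apply: contraNneq nxy => /setP/(_ y); rewrite !inE.
apply: leq_trans (kcut X X0 XT) _.
(* Forgetting the orientation loses nothing: the end in [X] always comes first. *)
rewrite -(card_in_imset (f := fun p : T * T => [set p.1; p.2])); last first.
  move=> [a b] [c d]; rewrite !inE /= => /and3P[aX bX _] /and3P[cX dX _] E.
  have /set2P[ac|ad] : a \in [set c; d] by rewrite -E !inE eqxx.
    have /set2P[bc|->] : b \in [set c; d] by rewrite -E !inE eqxx orbT.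
      by rewrite bc cX in bX.
    by rewrite ac.
  by rewrite -ad aX in dX.
apply/subset_leq_card/subsetP => B /imsetP[[a b]].
rewrite inE /= !inE => /and3P[aX bX eab] ->; apply: contraNT bX => abF.
by apply: connect_trans aX (connect1 _); rewrite /delete_edges eab.
Qed.

(** * Distance and adjacency in the square *)

Lemma has_walk_dist (T : finType) (e : rel T) (x y : T) :
  connect e x y -> has_walk e (dist e x y) x y.
Proof.
case/connectP => p0 ep0 ->; case/shortenP: ep0 => p ep up _.
have szp : size p < #|T|.
  by rewrite -[(size p).+1]/(size (x :: p)) -(card_uniqP up) max_card.
have walks : has (fun k => has_walk e k x (last x p)) (iota 0 #|T|).
  apply/hasP; exists (size p); first by rewrite mem_iota.
  by apply/existsP; exists (in_tuple p); rewrite ep /= eqxx.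
have := nth_find 0 walks; rewrite has_find size_iota in walks.
by rewrite nth_iota.
Qed.

Lemma dist_le (T : finType) (e : rel T) (k : nat) (x y : T) :
  has_walk e k x y -> dist e x y <= k.
Proof.
move=> kw; rewrite leqNgt; apply/negP => ltk.
have kT : k < #|T|.
  by apply: leq_trans ltk _; rewrite -[X in _ <= X](size_iota 0) find_size.
by have := before_find 0 ltk; rewrite nth_iota // kw.
Qed.

Lemma squareP (T : finType) (e : rel T) (x y : T) :
  reflect (x != y /\ (e x y \/ exists2 z, e x z & e z y)) (square e x y).
Proof.
apply: (iffP and3P) => [[nxy cxy]|[nxy exy]].
  have := has_walk_dist cxy; case: (dist e x y) => [|[|[|//]]] /existsP[p].
  - by rewrite (tuple0 p) /= (negPf nxy).
  - case/tupleP: p => z p; rewrite (tuple0 p) /= andbT => /andP[exz /eqP zy].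
    by rewrite zy in exz; split; [|left].
  - case/tupleP: p => z p; case/tupleP: p => w p; rewrite (tuple0 p) /= andbT.
    case/andP => /andP[exz ezw] /eqP wy; rewrite wy in ezw.
    by split=> //; right; exists z.
split=> //.
  case: exy => [/connect1 //|[z exz ezy]].
  exact: connect_trans (connect1 exz) (connect1 ezy).
case: exy => [exy|[z exz ezy]].
  apply: (@leq_trans 1) => //; apply: dist_le.
  by apply/existsP; exists [tuple y]; rewrite /= exy eqxx.
apply: dist_le; apply/existsP; exists [tuple z; y].
by rewrite /= exz ezy eqxx.
Qed.

Lemma square_sym (T : finType) (e : rel T) : symmetric e -> symmetric (square e).
Proof.
move=> sym x y; apply/squareP/squareP => -[nxy exy]; rewrite eq_sym; split=> //;
  by case: exy => [|[z]]; [left; rewrite sym|right; exists z; rewrite sym].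
Qed.

Lemma square_irr (T : finType) (e : rel T) : irreflexive (square e).
Proof. by move=> x; rewrite /square eqxx. Qed.

(** * Closed neighbourhoods as cliques of the square *)

Definition closed_nbhd (T : finType) (e : rel T) (x : T) : {set T} :=
  x |: [set y | e x y].

Lemma card_closed_nbhd (T : finType) (e : rel T) (x : T) :
  irreflexive e -> #|closed_nbhd e x| = (degree e x).+1.
Proof. by move=> irr; rewrite cardsU1 inE irr. Qed.

Lemma closed_nbhd_clique (T : finType) (e : rel T) (c a b : T) :
  symmetric e -> a \in closed_nbhd e c -> b \in closed_nbhd e c -> a != b ->
  square e a b.
Proof.
move=> sym; rewrite !inE => ac bc nab; apply/squareP; split=> //.
case/predU1P: ac nab => [->|eca] nab.
  by case/predU1P: bc nab => [->|]; [rewrite eqxx|left].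
case/predU1P: bc nab => [->|ecb] nab; first by left; rewrite sym.
by right; exists c; rewrite // sym.
Qed.

(** * Cuts smaller than the minimum degree *)

Lemma small_cut_interior (T : finType) (h : rel T) (X : {set T}) :
  irreflexive h -> X != set0 -> #|cut h X| < min_degree h ->
  exists2 x, x \in X & forall y, h x y -> y \in X.
Proof.
(* If every vertex of [X] had a neighbour outside [X], the cut would contain the
   edges from [x] leaving [X] and one more edge for each neighbour of [x] in
   [X]. *)
move=> irr /set0Pn[x xX]; rewrite ltnNge => cut_lt.
have [/exists_inP[z zX /forallP zint]|] :=
    boolP [exists z in X, [forall y, h z y ==> (y \in X)]].
  by exists z => // y; exact/implyP/zint.
rewrite negb_exists_in => /forall_inP no_int; case/negP: cut_lt.
have out_nbr z : z \in X -> {y | h z y && (y \notin X)}.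
  move=> zX; apply/sigW; have := no_int z zX; rewrite negb_forall => /existsP[y].
  by rewrite negb_imply; exists y.
pose g z := if [pick y | h z y && (y \notin X)] is Some y then y else z.
have gP z : z \in X -> h z (g z) && (g z \notin X).
  move=> /out_nbr[y zy]; rewrite /g; case: pickP => [//|/(_ y)].
  by rewrite zy.
apply: leq_trans (min_degree_le h x) _; rewrite /degree.
pose f y := if y \in X then (y, g y) else (x, y).
rewrite -(card_in_imset (f := f)).
  apply/subset_leq_card/subsetP => B /imsetP[y]; rewrite inE /f => hxy ->.
  have [yX|yX] := boolP (y \in X); rewrite inE /=.
    by have /andP[-> ->] := gP y yX; rewrite yX.
  by rewrite xX yX.
move=> y z; rewrite !inE /f => hxy hxz.
have [yX|yX] := boolP (y \in X); have [zX|zX] := boolP (z \in X) => -[] //.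
  by move=> yx; rewrite yx irr in hxy.
by move=> zx; rewrite -zx irr in hxz.
Qed.

Lemma min_degree_lt_side (T : finType) (h : rel T) (X : {set T}) (x : T) :
  irreflexive h -> x \in X -> (forall y, h x y -> y \in X) ->
  min_degree h < #|X|.
Proof.
move=> irr xX xint; apply: (@leq_ltn_trans (degree h x)); first exact: min_degree_le.
rewrite -(card_closed_nbhd x irr); apply/subset_leq_card/subsetP => y.
by rewrite !inE => /predU1P[->//|/xint].
Qed.

(** The product counts the cut edges inside the clique [closed_nbhd e c]. If these were all, take an
    edge [x y] leaving the set [W] of vertices of [X] without square-neighbours outside [X]. Then
    [y] is an end of a cut edge, hence a neighbour of [c], which puts [c] within distance 2 of
    [x]. *)
Lemma clique_lt_cut (T : finType) (e : rel T) (X : {set T}) (c x0 : T) :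
  symmetric e -> connected_graph e ->
  c \notin X -> x0 \in X -> (forall y, square e x0 y -> y \in X) ->
  #|closed_nbhd e c :&: X| * #|closed_nbhd e c :\: X| < #|cut (square e) X|.
Proof.
move=> sym con cX x0X x0int; rewrite -cardsX ltnNge; apply/negP => cut_le.
have sub : setX (closed_nbhd e c :&: X) (closed_nbhd e c :\: X)
    \subset cut (square e) X.
  apply/subsetP => -[a b]; rewrite in_setX in_setI in_setD.
  case/andP => /andP[ac aX] /andP[bX bc].
  rewrite inE /= aX bX (closed_nbhd_clique sym ac bc) //.
  by apply: contraNneq bX => <-.
have /eqP cutE : setX (closed_nbhd e c :&: X) (closed_nbhd e c :\: X)
    == cut (square e) X by rewrite eqEcard sub.
pose W := [set x in X | [forall y, square e x y ==> (y \in X)]].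
have x0W : x0 \in W.
  by rewrite inE x0X; apply/forallP => y; apply/implyP/x0int.
have cW : c \notin W by rewrite inE (negPf cX).
have [x [y [xW yW exy]]] := connected_leaving_edge con x0W cW.
move: xW; rewrite inE => /andP[xX /forallP xint].
have yX : y \in X.
  have [<- //|nxy] := eqVneq x y.
  by have /implyP := xint y; apply; apply/squareP; split=> //; left.
move: yW; rewrite inE yX /= negb_forall => /existsP[z].
rewrite negb_imply => /andP[hyz zX].
have : (y, z) \in cut (square e) X by rewrite inE /= yX zX.
rewrite -cutE !inE /= => /andP[/andP[/predU1P[yc|ecy] _] _].
  by rewrite yc (negPf cX) in yX.
have nxc : x != c by apply: contraNneq cX => <-.
have /implyP xc := xint c; case/negP: cX; apply: xc.
by apply: (@closed_nbhd_clique _ _ y); rewrite ?inE // sym ?exy ?ecy orbT.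
Qed.

Lemma small_side_cut (T : finType) (e : rel T) (X : {set T}) (d : nat) :
  symmetric e -> irreflexive e -> connected_graph e ->
  (forall x, d <= degree e x) -> #|T| <= 4 * d + 1 ->
  X != set0 -> 2 * #|X| <= #|T| ->
  min_degree (square e) <= #|cut (square e) X|.
Proof.
move=> sym irr con deg_ge n_le X0 X_le; rewrite leqNgt; apply/negP => cut_lt.
have hsym := square_sym sym; have hirr := @square_irr T e.
have [x xX xint] := small_cut_interior hirr X0 cut_lt.
have ltX := min_degree_lt_side hirr xX xint.
have Y0 : ~: X != set0.
  by rewrite -card_gt0 cardsCs setCK; move: X0; rewrite -card_gt0; lia.
have [y yY yint] : exists2 y, y \in ~: X & forall z, square e y z -> z \in ~: X.
  by apply: small_cut_interior; rewrite ?card_cutC.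
have clique_lt c :
    #|closed_nbhd e c :&: X| * #|closed_nbhd e c :\: X| < #|cut (square e) X|.
  (* For [c] in [X] the two sides swap roles, with [y] in place of [x]. *)
  have [cX|cX] := boolP (c \in X); last exact: clique_lt_cut xX xint.
  rewrite mulnC -[X in #|_ :&: X|]setCK -setDE -card_cutC // setDE.
  by apply: (clique_lt_cut sym con _ yY yint); rewrite inE cX.
have nbhd_ge c : d < #|closed_nbhd e c :&: X| + #|closed_nbhd e c :\: X|.
  by rewrite cardsID card_closed_nbhd // ltnS.
have thin c : #|closed_nbhd e c :&: X| <= 1 \/ #|closed_nbhd e c :\: X| <= 1.
  (* Two parts of size at least 2 and sum at least [d + 1] have product at least [2 * (d - 1)],
     while the cut has at most [#|X| - 2] edges. *)
  by have := clique_lt c; have := nbhd_ge c; nia.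
have inner v : v \notin X -> #|closed_nbhd e v :&: X| <= 1.
  move=> vX; have [//|Y1] := thin v.
  (* Otherwise [X] would contain disjoint sets of at least [d + 1] and [d] vertices, although
     [#|X| <= 2 * d]. *)
  have sub : closed_nbhd e x :|: (closed_nbhd e v :&: X) \subset X.
    rewrite subUset subsetIr andbT; apply/subsetP => z.
    rewrite !inE => /predU1P[->//|exz]; have [<-//|nxz] := eqVneq x z.
    by apply: xint; apply/squareP; split=> //; left.
  have dis : closed_nbhd e x :&: (closed_nbhd e v :&: X) = set0.
    apply/setP => z; rewrite in_set0; apply/negP => /setIP[zx /setIP[zv _]].
    have xz : x \in closed_nbhd e z.
      by move: zx; rewrite !inE eq_sym sym.
    have vz : v \in closed_nbhd e z.
      by move: zv; rewrite !inE eq_sym sym.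
    case/negP: (vX); apply: xint; apply: (closed_nbhd_clique sym xz vz).
    by apply: contraNneq vX => <-.
  have := subset_leq_card sub; rewrite cardsU dis cards0 subn0 card_closed_nbhd //.
  by have := deg_ge x; have := nbhd_ge v; lia.
(* An edge [u' u] leaving [W] yields a vertex [u] of [X] with neighbours on both sides. *)
pose W := [set w in X | [forall z, e w z ==> (z \in X)]].
have xW : x \in W.
  rewrite inE xX; apply/forallP => z; apply/implyP => exz.
  have [<-//|nxz] := eqVneq x z.
  by apply: xint; apply/squareP; split=> //; left.
have yW : y \notin W by rewrite inE; move: yY; rewrite inE => /negPf ->.
have [u' [u [u'W uW eu'u]]] := connected_leaving_edge con xW yW.
move: u'W; rewrite inE => /andP[u'X /forallP/(_ u)/implyP/(_ eu'u) uX].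
move: uW; rewrite inE uX /= negb_forall => /existsP[v].
rewrite negb_imply => /andP[euv vX].
have nu'u : u' != u by apply: contraTneq eu'u => ->; rewrite irr.
have u_out : #|closed_nbhd e u :\: X| <= 1.
  have [u_in|//] := thin u; case/negP: nu'u; apply/eqP.
  by apply: (card_le1_eqP u_in); rewrite !inE ?eqxx ?uX // sym eu'u u'X orbT.
have v_in := inner v vX.
pose N := [set w | e u w] :|: [set w | e v w].
(* A common neighbour [w] would be a second vertex beside [u] of [closed_nbhd e v] in [X], or a
   second one beside [v] of [closed_nbhd e u] outside [X]. *)
have disj : [set w | e u w] :&: [set w | e v w] = set0.
  apply/setP => w; rewrite !inE; apply/negP => /andP[euw evw].
  have [wX|wX] := boolP (w \in X).
    suff wu : w = u by rewrite wu irr in euw.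
    by apply: (card_le1_eqP v_in); rewrite !inE ?evw ?wX ?uX ?orbT // sym euv orbT.
  suff wv : w = v by rewrite wv irr in evw.
  by apply: (card_le1_eqP u_out); rewrite !inE ?euw ?euv ?wX ?vX ?orbT.
have N_ge : 2 * d <= #|N|.
  rewrite cardsU disj cards0 subn0 -/(degree e u) -/(degree e v) mul2n -addnn.
  exact: leq_add.
have nuv : u != v by apply: contraNneq vX => <-.
have N_u w : w \in N -> w != u -> square e u w.
  rewrite inE !inE eq_sym => euvw nwu; apply/squareP; split=> //.
  by case/orP: euvw => [|evw]; [left|right; exists v].
have N_v w : w \in N -> w != v -> square e w v.
  rewrite inE !inE => euvw nwv; apply/squareP; split=> //.
  by case/orP: euvw => [euw|evw]; [right; exists u; rewrite // sym|left; rewrite sym].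
(* Both [u] and [v] are sent to the edge [u v], so [u] is dropped from [N]; this is the loss of 1 in
   [2 * d - 1]. *)
pose f w := if w \in X then (w, v) else (u, w).
have f_inj : {in N :\ u &, injective f}.
  move=> a b; rewrite !in_setD1 /f => /andP[au _] /andP[bu _].
  have [aX|aX] := boolP (a \in X); have [bX|bX] := boolP (b \in X) => -[] //.
    by move=> au'; rewrite au' eqxx in au.
  by move=> ub; rewrite -ub eqxx in bu.
have : #|N :\ u| <= #|cut (square e) X|.
  rewrite -(card_in_imset f_inj); apply/subset_leq_card/subsetP => B /imsetP[w].
  rewrite in_setD1 /f => /andP[nwu wN] ->.
  have [wX|wX] := boolP (w \in X); rewrite inE /=.
    by rewrite wX vX N_v //; apply: contraNneq vX => <-.
  by rewrite uX wX N_u.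
have := cardsD1 u N; have := leq_b1 (u \in N).
by clear - N_ge n_le X_le ltX cut_lt; lia.
Qed.

Theorem theorem2 (T : finType) (e : rel T) :
  simple_graph e ->
  connected_graph e ->
  (#|T| + 2) %/ 4 <= min_degree e ->
  maximally_edge_connected (square e).
Proof.
move=> [sym irr] con deg_ge.
have hsym := square_sym sym; have hirr := @square_irr T e.
have /andP[T_gt0 _] := con; have /card_gt0P[x0 _] := T_gt0.
apply/eqP; rewrite eqn_leq; apply/andP; split.
  (* The default [#|T|] of the minimum has to be bounded as well; the degree of [x0] lies below
     it. *)
  apply: bigminn_ge => [|x _]; last exact: edge_connectivity_le_degree.
  apply: leq_trans (edge_connectivity_le_degree x0 hsym hirr) _.
  exact/ltnW/degree_lt_card.
apply: edge_connectivity_ge => // [|X X0 XT].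
  exact: leq_trans (min_degree_le _ x0) (degree_le_edges _ x0).
(* The floor condition says that [#|T| + 2 < 4 * (min_degree e + 1)]. *)
have n_le : #|T| <= 4 * min_degree e + 1 by lia.
have deg_le := min_degree_le e.
(* A set and its complement have equally large cuts, so the smaller side can be taken. *)
have [X_le|X_gt] := leqP (2 * #|X|) #|T|; first exact: small_side_cut n_le _ _.
rewrite -card_cutC //; apply: small_side_cut n_le _ _ => //.
  by apply: contraNneq XT => XC; rewrite -[X]setCK XC setC0.
by have := cardsC X; lia.
Qed.
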